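(* Let $(X,d,\Gamma)$ be a principally complete ultrametric space such that $X$ has at least two elements and $\Gamma^{\bullet}=\Gamma\setminus\{0\}$ does not have a smallest element. Let $\varphi:X\to X$ be a strictly contracting mapping and let $z$ be its unique fixed point. Let $\kappa$ be a limit ordinal with $\operatorname{card}\kappa>\operatorname{card}\Gamma$, and for $y\in X$ let $\mathcal{P}_y$ be the set of families of length $<\kappa$ beginning at $y$ associated with $\varphi$ (defined in the context). If $y\in X$, $y\ne z$, then either there exists $\alpha\in\mathcal{P}_y$ which reaches $z$, or, if this is not the case, there exists an (asymptotic) approximation $\alpha\in\mathcal{P}_y$ to $z$.
   Context: $(\Gamma,\le)$ is a (partially) ordered set with smallest element $0$, and $\Gamma^\bullet=\Gamma\setminus\{0\}$. An ultrametric space $(X,d,\Gamma)$ is a non-empty set $X$ with $d:X\times X\to\Gamma$ such that for all $x,y,w\in X$, $\gamma\in\Gamma$: $d(x,y)=0$ iff $x=y$; $d(x,y)=d(y,x)$; if $d(x,y)\le\gamma$ and $d(y,w)\le\gamma$ then $d(x,w)\le\gamma$. For $\gamma\in\Gamma^\bullet$, $a\in X$, the ball is $B_\gamma(a)=\{x\in X\mid d(a,x)\le\gamma\}$. A principal ball is a ball of the form $B_{d(x,y)}(x)$ with $x\ne y$. $X$ is principally complete if every chain (set totally ordered by inclusion) of principal balls of $X$ has non-empty intersection. $\varphi:X\to X$ is strictly contracting if $d(\varphi(x),\varphi(x'))<d(x,x')$ for all $x\neq x'$ in $X$. It is a known theorem that a strictly contracting self-map of a principally complete ultrametric space has exactly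 one fixed point. For an ordinal $\lambda<\kappa$, $\mathcal{P}_\lambda$ is the set of all families $\alpha=(a_\iota)_{\iota<\lambda}$ of elements of $X$ (indexed by the ordinals $\iota<\lambda$) such that: (i) if $\iota+1<\lambda$ then $a_{\iota+1}=\varphi(a_\iota)\ne a_\iota$; (ii) the family $(d(a_\iota,a_{\iota+1}))_{\iota+1<\lambda}$ is strictly decreasing; (iii) if $\mu<\lambda$ is a limit ordinal then $d(a_\mu,a_\iota)\le d(a_\iota,a_{\iota+1})$ for all $\iota<\mu$. $\mathcal{P}=\bigcup_{\lambda<\kappa}\mathcal{P}_\lambda$, and for $y\in X$, $\mathcal{P}_y$ is the set of families in $\mathcal{P}$ with $a_0=y$. $\alpha=(a_\iota)_{\iota<\lambda}\in\mathcal{P}$ reaches $z$ if there is $\iota_0<\lambda$ with $a_{\iota_0}=z$. For a limit ordinal $\lambda$ and $\alpha=(a_\iota)_{\iota<\lambda}\in\mathcal{P}$, put $B_\iota(\alpha)=B_{d(a_\iota,\varphi(a_\iota))}(a_\iota)$ for $\iota<\lambda$ and $I_\lambda(\alpha)=\bigcap_{\iota<\lambda}B_\iota(\alpha)$. $\alpha=(a_\iota)_{\iota<\lambda}\in\mathcal{P}$ is an (asymptotic) approximation to $z$ if $\lambda$ is a limit ordinal and $I_\lambda(\alpha)=\{z\}$. *)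

(* Defs.v *)
From mathcomp Require Import all_boot all_order.
From mathcomp Require Import boolp classical_sets cardinality wochoice.

Set Implicit Arguments.
Unset Strict Implicit.
Unset Printing Implicit Defensive.

Import Order.TTheory.

Local Open Scope classical_set_scope.
Local Open Scope order_scope.

(* Ultrametric spaces over a partially ordered set [Gam] with least element
   [\bot], which plays the role of 0. *)

Record is_ultrametric_space (disp : Order.disp_t) (Gam : bPOrderType disp)
    (X : Type) (d : X -> X -> Gam) : Prop := {
  ultrametric_inhabited : inhabited X;
  ultrametric_eq0 : forall x y, d x y = \bot <-> x = y;
  ultrametric_sym : forall x y, d x y = d y x;
  ultrametric_triangle : forall x y w (g : Gam),
    d x y <= g -> d y w <= g -> d x w <= g
}.

Definition uball (disp : Order.disp_t) (Gam : bPOrderType disp) (X : Type)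
    (d : X -> X -> Gam) (g : Gam) (a : X) : set X :=
  [set x | d a x <= g].

Definition principal_ball (disp : Order.disp_t) (Gam : bPOrderType disp)
    (X : Type) (d : X -> X -> Gam) : set (set X) :=
  [set B | exists x y, x <> y /\ B = uball d (d x y) x].

(* The empty chain imposes nothing: its intersection is all of [X]. *)
Definition principally_complete (disp : Order.disp_t) (Gam : bPOrderType disp)
    (X : Type) (d : X -> X -> Gam) : Prop :=
  forall F : set (set X), F `<=` principal_ball d -> total_on F subset ->
    \bigcap_(B in F) B !=set0.

Definition strictly_contracting (disp : Order.disp_t) (Gam : bPOrderType disp)
    (X : Type) (d : X -> X -> Gam) (phi : X -> X) : Prop :=
  forall x x', x <> x' -> d (phi x) (phi x') < d x x'.

(* An ordinal kappa is given as a well-ordered type [K]. The elements of [K] are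
   the ordinals below kappa: [l : K] stands for the order type of its initial
   segment, so "lambda < kappa" is "[l : K]" and "iota < lambda" is
   "[i : segment l]". *)

Definition is_succ (disp : Order.disp_t) (K : orderType disp) (i j : K) : Prop :=
  i < j /\ forall k, i < k -> j <= k.

Definition is_zero (disp : Order.disp_t) (K : orderType disp) (i : K) : Prop :=
  forall k, i <= k.

Definition is_limit (disp : Order.disp_t) (K : orderType disp) (l : K) : Prop :=
  ~ is_zero l /\ ~ exists i, is_succ i l.

(* The order type of [K] itself, which is not an element of [K], is a limit
   ordinal: it is not 0, and it is not a successor as [K] has no largest
   element. *)
Definition limit_ordinal (disp : Order.disp_t) (K : orderType disp) : Prop :=
  [/\ well_order (<=%O : rel K), inhabited K &
      ~ exists m : K, forall k, k <= m].

Definition segment (disp : Order.disp_t) (K : orderType disp) (l : K) : Type :=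
  {i : K | i < l}.

Record ord_family (disp : Order.disp_t) (K : orderType disp) (X : Type) :=
  Family { len : K; term :> segment len -> X }.

(* In the three clauses below, an index [i] with a successor [j] in the segment
   is exactly an iota with iota + 1 < lambda. *)
Record is_phi_family (dispG : Order.disp_t) (Gam : bPOrderType dispG) (X : Type)
    (d : X -> X -> Gam) (phi : X -> X) (dispK : Order.disp_t)
    (K : orderType dispK) (a : ord_family K X) : Prop := {
  phi_family_succ : forall i j : segment (len a),
    is_succ (sval i) (sval j) -> a j = phi (a i) /\ a j <> a i;
  phi_family_decr : forall i i' j j' : segment (len a),
    is_succ (sval i) (sval i') -> is_succ (sval j) (sval j') ->
    sval i < sval j -> d (a j) (a j') < d (a i) (a i');
  phi_family_limit : forall m i i' : segment (len a),
    is_limit (sval m) -> sval i < sval m -> is_succ (sval i) (sval i') ->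
    d (a m) (a i) <= d (a i) (a i')
}.

Definition starts_at (disp : Order.disp_t) (K : orderType disp) (X : Type)
    (a : ord_family K X) (y : X) : Prop :=
  exists i : segment (len a), is_zero (sval i) /\ a i = y.

Definition phi_families_from (dispG : Order.disp_t) (Gam : bPOrderType dispG)
    (X : Type) (d : X -> X -> Gam) (phi : X -> X) (dispK : Order.disp_t)
    (K : orderType dispK) (y : X) : set (ord_family K X) :=
  [set a | is_phi_family d phi a /\ starts_at a y].

Definition reaches (disp : Order.disp_t) (K : orderType disp) (X : Type)
    (a : ord_family K X) (z : X) : Prop :=
  exists i : segment (len a), a i = z.

Definition approx_ball (dispG : Order.disp_t) (Gam : bPOrderType dispG)
    (X : Type) (d : X -> X -> Gam) (phi : X -> X) (dispK : Order.disp_t)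
    (K : orderType dispK) (a : ord_family K X) (i : segment (len a)) : set X :=
  uball d (d (a i) (phi (a i))) (a i).

Definition is_approximation (dispG : Order.disp_t) (Gam : bPOrderType dispG)
    (X : Type) (d : X -> X -> Gam) (phi : X -> X) (dispK : Order.disp_t)
    (K : orderType dispK) (a : ord_family K X) (z : X) : Prop :=
  is_limit (len a) /\
  \bigcap_(i in [set: segment (len a)]) approx_ball d phi i = [set z].

(* Main.v *)
(* Iterate [phi] from [y] transfinitely, choosing at a limit stage a point other
   than [z] in the intersection of the balls built so far, and [z] only when that
   intersection contains no other point. As long as [z] is not met, the values
   [d a_i (phi a_i)] strictly decrease, so cardinality forces [z] to be met. If
   the first time is a successor, [z] is reached; if it is a limit [l],
   principal completeness shows that the intersection over [l] is [{z}]. *)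
Require Import Defs.
From mathcomp Require Import all_boot all_order.
From mathcomp Require Import boolp classical_sets cardinality wochoice.

Set Implicit Arguments.
Unset Strict Implicit.
Unset Printing Implicit Defensive.

Import Order.TTheory.

Local Open Scope classical_set_scope.
Local Open Scope card_scope.
Local Open Scope order_scope.

(** * Well-ordered index types: least elements, successors, limits, recursion *)

Lemma well_order_least (disp : Order.disp_t) (K : orderType disp)
    (P : K -> Prop) :
  well_order (<=%O : rel K) -> (exists i, P i) ->
  exists2 l, P l & forall k, P k -> l <= k.
Proof.
move=> wK [i Pi].
have [|l [[/asboolP Pl minl] _]] := wK (fun k => `[< P k >]).
  by exists i; apply/asboolP.
by exists l => // k Pk; apply/minl/asboolP.
Qed.

Lemma well_order_wf (disp : Order.disp_t) (K : orderType disp) :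
  well_order (<=%O : rel K) -> well_founded (fun i j : K => i < j).
Proof.
move=> wK i; apply: contrapT => nAi.
have [l nAl minl] := well_order_least wK (ex_intro (fun k => ~ Acc _ k) i nAi).
apply: nAl; constructor=> j ltjl; apply: contrapT => /minl.
by rewrite leNgt ltjl.
Qed.

Lemma well_order_succ (disp : Order.disp_t) (K : orderType disp) (i m : K) :
  well_order (<=%O : rel K) -> i < m -> exists2 j, is_succ i j & j <= m.
Proof.
move=> wK ltim.
have [j ltij minj] := well_order_least wK (ex_intro (fun k => i < k) m ltim).
by exists j => //; apply: minj.
Qed.

Lemma is_succ_uniq (disp : Order.disp_t) (K : orderType disp) (i j k : K) :
  is_succ i j -> is_succ i k -> j = k.
Proof.
by move=> [ij minj] [ik mink]; apply/eqP; rewrite eq_le minj// mink.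
Qed.

Lemma is_succ_le (disp : Order.disp_t) (K : orderType disp) (i j k : K) :
  is_succ i j -> k < j -> k <= i.
Proof. by move=> [_ minj]; apply: contraTT; rewrite -ltNge -leNgt => /minj. Qed.

Lemma zero_succ_limit (disp : Order.disp_t) (K : orderType disp) (j : K) :
  [\/ is_zero j, exists i, is_succ i j | is_limit j].
Proof.
have [j0|j0] := pselect (is_zero j); first exact: Or31.
by have [js|js] := pselect (exists i, is_succ i j); [apply: Or32|apply: Or33].
Qed.

Lemma limit_succ_lt (disp : Order.disp_t) (K : orderType disp) (i j : K) :
  well_order (<=%O : rel K) -> is_limit j -> i < j ->
  exists2 k, is_succ i k & k < j.
Proof.
move=> wK [_ jlim] ltij; have [k ik lekj] := well_order_succ wK ltij.
exists k => //; rewrite lt_neqAle lekj andbT; apply/eqP => kj.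
by apply: jlim; exists i; rewrite -kj.
Qed.

(** Well-founded recursion with a choice at each stage. The recursion supplies only the values below
    [j], whereas [P] takes a total function; locality of [P] allows the choice to be made on any
    extension and carried over to the final sequence. *)
Lemma transfinite_choice (disp : Order.disp_t) (K : orderType disp) (X : Type)
    (x0 : X) (P : K -> (K -> X) -> X -> Prop) :
  well_order (<=%O : rel K) ->
  (forall j f g x, (forall i, i < j -> f i = g i) -> P j f x -> P j g x) ->
  (forall j f, exists x, P j f x) ->
  exists a : K -> X, forall j, P j a (a j).
Proof.
move=> wK Ploc Pex.
(* [x0] is a filler at indices not below [j], invisible to [P j] by locality. *)
pose ext j (r : forall i : K, i < j -> X) i :=
  if pselect (i < j) is left h then r i h else x0.
pose F j r := projT1 (cid (Pex j (ext j r))).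
pose a := Fix (well_order_wf wK) (fun=> X) F.
have aE j : a j = F j (fun i _ => a i).
  apply: (Fix_eq _ (fun=> X) F) => k f g fg; congr F.
  by apply: functional_extensionality_dep => i;
    apply: functional_extensionality_dep => h.
exists a => j; rewrite [X in P _ _ X]aE /F; case: cid => x /= Px.
by apply: Ploc Px => i ltij; rewrite /ext; case: pselect.
Qed.

Lemma injective_card_le (T U : Type) (f : T -> U) :
  injective f -> [set: T] #<= [set: U].
Proof.
move=> fI; apply: card_le_trans (card_leT (f @` setT)).
have /card_eqPle[] // : f @` setT #= [set: T].
by apply: inj_card_eq => x y _ _; apply: fI.
Qed.

(** * The transfinite iteration of [phi] *)

Definition limit_point (dispG : Order.disp_t) (Gam : bPOrderType dispG)
    (X : Type) (d : X -> X -> Gam) (phi : X -> X) (dispK : Order.disp_t)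
    (K : orderType dispK) (j : K) (f : K -> X) : set X :=
  [set x | forall i, i < j -> d (f i) x <= d (f i) (phi (f i))].

(** A relation, since the limit clause leaves a choice. Its second alternative takes [z] as a
    default even when the intersection is empty, so that a step always exists and completeness can
    enter later. *)
Definition phi_step (dispG : Order.disp_t) (Gam : bPOrderType dispG)
    (X : Type) (d : X -> X -> Gam) (phi : X -> X) (y z : X)
    (dispK : Order.disp_t) (K : orderType dispK) (j : K) (f : K -> X) (x : X)
    : Prop :=
  [/\ is_zero j -> x = y,
      forall i, is_succ i j -> x = phi (f i) &
      is_limit j -> (x <> z /\ limit_point d phi j f x) \/
                    (x = z /\ limit_point d phi j f `<=` [set z])].

Lemma phi_sequence_exists (dispG : Order.disp_t) (Gam : bPOrderType dispG)
    (X : Type) (d : X -> X -> Gam) (phi : X -> X) (y z : X)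
    (dispK : Order.disp_t) (K : orderType dispK) :
  well_order (<=%O : rel K) ->
  exists a : K -> X, forall j, phi_step d phi y z j a (a j).
Proof.
move=> wK; apply: transfinite_choice => //.
  move=> j f g x fg [x0 xS xL].
  have fgP : limit_point d phi j f = limit_point d phi j g.
    by apply/seteqP; split=> u fu i ltij;
      [rewrite -fg//|rewrite fg//]; apply: fu.
  split=> // [i ij|]; first by rewrite (xS i ij) fg//; case: ij.
  by rewrite -fgP.
move=> j f; case: (zero_succ_limit j) => [j0|[i ij]|jlim].
- exists y; split=> // [i [ltij _]|[]//].
  by move: (j0 i); rewrite leNgt ltij.
- exists (phi (f i)); split=> [j0|k kj|[_ []]]; last by exists i.
    by case: ij => + _; rewrite ltNge j0.
  have [[ltij _] [ltkj _]] := (ij, kj).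
  congr (phi (f _)); apply/eqP.
  by rewrite eq_le (is_succ_le kj ltij) (is_succ_le ij ltkj).
- have [[x [xz fx]]|nx] :=
    pselect (exists x, x <> z /\ limit_point d phi j f x).
    exists x; split=> [|i ij|_]; [by case: jlim| |by left].
    by case: jlim => _ []; exists i.
  exists z; split=> [|i ij|_]; [by case: jlim| |right].
    by case: jlim => _ []; exists i.
  by split=> // x fx; apply: contrapT => xz; apply: nx; exists x.
Qed.

(** Both bounds go through one induction on [j], as the first at a successor uses both at its
    predecessor. A successor [j] may carry [z]; at a limit this is excluded, because there [z] may
    be a default value outside the balls. *)
Lemma phi_sequence_decr (dispG : Order.disp_t) (Gam : bPOrderType dispG)
    (X : Type) (d : X -> X -> Gam) (phi : X -> X) (y z : X)
    (dispK : Order.disp_t) (K : orderType dispK) (a : K -> X) (j : K) :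
  is_ultrametric_space d -> strictly_contracting d phi ->
  unique (fun x => phi x = x) z -> well_order (<=%O : rel K) ->
  (forall k, phi_step d phi y z k a (a k)) ->
  (forall i, i < j -> a i <> z) -> (is_limit j -> a j <> z) ->
  forall i, i < j -> d (a i) (a j) <= d (a i) (phi (a i)) /\
                     d (a j) (phi (a j)) < d (a i) (phi (a i)).
Proof.
move=> hd hphi [_ zU] wK aP.
have nfix x : x <> z -> x <> phi x by move=> xz xE; apply/xz/esym/zU.
have dxx x : d x x = \bot by apply/(ultrametric_eq0 hd).
have phi_le x x' : d (phi x) (phi x') <= d x x'.
  have [->|/hphi/ltW//] := pselect (x = x').
  by rewrite !dxx.
elim/(well_founded_ind (well_order_wf wK)): j => j IH ltz jz i ltij.
have {}IH k : k < j -> forall i, i < k ->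
    d (a i) (a k) <= d (a i) (phi (a i)) /\
    d (a k) (phi (a k)) < d (a i) (phi (a i)).
  move=> ltkj; apply: IH => // [k' ltk'|_]; last exact: ltz.
  exact: ltz (lt_trans ltk' ltkj).
case: (zero_succ_limit j) => [j0|[k kj]|jlim].
- by move: ltij; rewrite ltNge j0.
- have ltkj : k < j by case: kj.
  have -> : a j = phi (a k) by case: (aP j) => _ + _; apply.
  have lt1 := hphi _ _ (nfix _ (ltz k ltkj)).
  have := is_succ_le kj ltij; rewrite le_eqVlt => /predU1P[-> //|ltik].
  (* [a k] is within the radius at [i] of both [a i] and [phi (a k)]. *)
  have [le2 lt2] := IH k ltkj i ltik.
  split; last exact: lt_trans lt1 lt2.
  exact: (ultrametric_triangle hd) le2 (ltW lt2).
- have aj_lim : limit_point d phi j a (a j).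
    by case: (aP j) => _ _ /(_ jlim) [[]//|[ajz _]]; case: (jz jlim).
  split; first exact: aj_lim.
  (* The weak bound at the successor of [i], itself below the limit [j], gives
     the strict bound at [i]. *)
  have le_aj k : k < j -> d (a j) (phi (a j)) <= d (a k) (phi (a k)).
    (* [a j] and [a k] are within the radius at [k] of each other, hence so are their images; the
       path from [a j] to [phi (a j)] passes through [phi (a k)]. *)
    move=> /aj_lim lek; apply: (ultrametric_triangle hd (y := phi (a k))).
      by apply: (ultrametric_triangle hd) (lexx _); rewrite (ultrametric_sym hd).
    exact: le_trans (phi_le _ _) lek.
  have [k ik ltkj] := limit_succ_lt wK jlim ltij.
  apply: le_lt_trans (le_aj k ltkj) _.
  by case: (IH k ltkj i _) => //; case: ik.
Qed.

(** * Truncations of the iteration at an index [l] *)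

(** The hypotheses tolerate [z] at a last index that is not a limit. This covers both a family cut
    just after reaching [z] and one cut at a limit with no earlier [z]. *)
Lemma phi_sequence_family (dispG : Order.disp_t) (Gam : bPOrderType dispG)
    (X : Type) (d : X -> X -> Gam) (phi : X -> X) (y z : X)
    (dispK : Order.disp_t) (K : orderType dispK) (a : K -> X) (l : K) :
  is_ultrametric_space d -> strictly_contracting d phi ->
  unique (fun x => phi x = x) z -> well_order (<=%O : rel K) ->
  (forall k, phi_step d phi y z k a (a k)) -> ~ is_zero l ->
  (forall i j, i < j -> j < l -> a i <> z) ->
  (forall j, is_limit j -> j < l -> a j <> z) ->
  phi_families_from d phi y (Family (fun i : segment l => a (sval i))).
Proof.
move=> hd hphi zU wK aP l0 ltz limz.
have aS i j : is_succ i j -> a j = phi (a i) by case: (aP j) => _ + _; apply.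
have decr j : j < l -> forall i, i < j ->
    d (a i) (a j) <= d (a i) (phi (a i)) /\
    d (a j) (phi (a j)) < d (a i) (phi (a i)).
  move=> ltjl; apply: (phi_sequence_decr hd hphi zU wK aP) => [i ij|jlim].
    exact: ltz ij ltjl.
  exact: limz.
split; last first.
  have [o _ omin] := well_order_least wK (ex_intro (fun=> True) l I).
  have o0 : is_zero o by move=> k; apply: omin.
  have ol : o < l.
    by rewrite lt_neqAle o0 andbT; apply/eqP => ol; apply: l0; rewrite -ol.
  by exists (exist _ o ol); split=> //=; case: (aP o) => + _ _; apply.
split=> /=.
- move=> [i il] [j jl] /= ij; rewrite (aS _ _ ij); split=> // phia.
  by case: ij => ij _; apply: (ltz i j) => //; case: zU => _ /(_ _ phia).
- move=> [i il] [i' il'] [j jl] [j' jl'] /= ii' jj' ij.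
  by rewrite (aS _ _ ii') (aS _ _ jj'); case: (decr j jl i ij).
- move=> [m ml] [i il] [i' il'] /= _ im ii'.
  by rewrite (aS _ _ ii') (ultrametric_sym hd); case: (decr m ml i im).
Qed.

(** The value [z] at [l] certifies that the intersection has no other point; completeness, applied
    to the nested balls, makes it non-empty. *)
Lemma phi_sequence_approximation (dispG : Order.disp_t)
    (Gam : bPOrderType dispG) (X : Type) (d : X -> X -> Gam) (phi : X -> X)
    (y z : X) (dispK : Order.disp_t) (K : orderType dispK) (a : K -> X)
    (l : K) :
  is_ultrametric_space d -> principally_complete d ->
  strictly_contracting d phi -> unique (fun x => phi x = x) z ->
  well_order (<=%O : rel K) -> (forall k, phi_step d phi y z k a (a k)) ->
  is_limit l -> a l = z -> (forall i, i < l -> a i <> z) ->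
  is_approximation d phi (Family (fun i : segment l => a (sval i))) z.
Proof.
move=> hd hcomplete hphi zU wK aP llim alz ltz; split=> //.
set alpha := Family _; set I := \bigcap_(i in _) _.
have Isub : I `<=` [set z].
  case: (aP l) => _ _ /(_ llim) [[]//|[_ sub]] x Ix; apply: sub => i il.
  exact: (Ix (exist _ i il)).
suff [x Ix] : I !=set0.
  apply/seteqP; split=> // _ ->.
  by rewrite -(Isub x Ix).
(* For [i] before [j], the center [a j] lies in the ball at [i] and the radius at [j] is smaller. *)
have nested i j : sval i <= sval j ->
    approx_ball (a := alpha) d phi j `<=` approx_ball (a := alpha) d phi i.
  case: i j => [i il] [j jl] /=.
  rewrite le_eqVlt => /predU1P[ij|ij] x; rewrite /approx_ball/uball/=.
    by rewrite ij.
  move=> xj.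
  have [||le1 lt2] := phi_sequence_decr (j := j) hd hphi zU wK aP _ _ ij.
  - by move=> k kj; apply: ltz (lt_trans kj jl).
  - by move=> _; apply: ltz.
  - exact: (ultrametric_triangle hd) le1 (le_trans xj (ltW lt2)).
have [|_ _ [i ->] [j ->]|x Fx] :=
  hcomplete [set B | exists i, B = approx_ball (a := alpha) d phi i].
(* The second point of the principal ball is [phi (alpha i)], distinct from [alpha i] because [z] is
   the only fixed point. *)
- move=> _ [i ->]; exists (alpha i), (phi (alpha i)); split=> // phia.
  by apply: (ltz (sval i) (svalP i)); case: zU => _ /(_ _ (esym phia)).
- by have [ij|/ltW ji] := leP (sval i) (sval j); [right|left]; apply: nested.
- by exists x => i _; apply: Fx; exists i.
Qed.

Theorem corollary1 (dispG : Order.disp_t) (Gam : bPOrderType dispG) (X : Type)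
    (d : X -> X -> Gam) (phi : X -> X) (z : X)
    (dispK : Order.disp_t) (K : orderType dispK) (y : X)
    (hd : is_ultrametric_space d)
    (hcomplete : principally_complete d)
    (hX : exists x1 x2 : X, x1 <> x2)
    (hGam : ~ exists g : Gam,
        g <> \bot /\ forall g' : Gam, g' <> \bot -> g <= g')
    (hphi : strictly_contracting d phi)
    (hz : unique (fun x => phi x = x) z)
    (hK : limit_ordinal K)
    (hcard : ([set: Gam] #<= [set: K]) /\ ~ ([set: K] #<= [set: Gam]))
    (hy : y <> z) :
  (exists a : ord_family K X, phi_families_from d phi y a /\ reaches a z) \/
  (~ (exists a : ord_family K X, phi_families_from d phi y a /\ reaches a z) /\
   exists a : ord_family K X,
     phi_families_from d phi y a /\ is_approximation d phi a z).
Proof.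
case: hK => wK _ nomax.
have [a aP] := phi_sequence_exists d phi y z wK.
have [l alz minl] : exists2 l, a l = z & forall k, a k = z -> l <= k.
  (* If [z] never occurred, the radii would strictly decrease along all of [K] and embed [K] into
     [Gam], against [hcard]. *)
  apply: (well_order_least wK); apply: contrapT => naz.
  have anz k : a k <> z by move=> akz; apply: naz; exists k.
  have decr i j : i < j -> d (a j) (phi (a j)) < d (a i) (phi (a i)).
    by move=> ij; have [] // := phi_sequence_decr hd hphi hz wK aP _ _ ij.
  case: hcard => _; apply.
  apply: (injective_card_le (f := fun k => d (a k) (phi (a k)))) => i j ij.
  by have [/decr|/decr|//] := ltgtP i j; rewrite ij ltxx.
have ltz i : i < l -> a i <> z by move=> il /minl; rewrite leNgt il.
have reach_or : (exists k, is_succ k l) \/ is_limit l.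
  case: (zero_succ_limit l) => [l0|//|]; [|by left|by right].
  by case: hy; rewrite -alz; case: (aP l) => /(_ l0).
case: reach_or => [[k kl]|llim].
  (* To have [l] among its indices, the family is cut at the successor [m] of [l], which exists
     because [K] has no largest element. *)
  left; have [p lp] : exists p, l < p.
    apply: contrapT => np; apply: nomax; exists l => p.
    by rewrite leNgt; apply/negP => lp; apply: np; exists p.
  have [m lm _] := well_order_succ wK lp.
  have ltlm : l < m by case: lm.
  exists (Family (fun i : segment m => a (sval i))); split.
    apply: phi_sequence_family hd hphi hz wK aP _ _ _ => [m0|i j ij jm|j jlim jm].
    - by move: ltlm; rewrite ltNge m0.
    - exact: ltz (lt_le_trans ij (is_succ_le lm jm)).
    (* A limit index below [m] lies strictly below [l], which is a successor. *)
    - apply: ltz; rewrite lt_neqAle (is_succ_le lm jm) andbT.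
      by apply/eqP => jl; case: jlim => _ []; exists k; rewrite jl.
  by exists (exist _ l ltlm).
(* A family built from other choices at limit stages might still reach [z]; the second alternative
   of the statement has to exclude this. *)
have [?|nreach] := pselect (exists a : ord_family K X,
  phi_families_from d phi y a /\ reaches a z); first by left.
right; split=> //; exists (Family (fun i : segment l => a (sval i))); split.
  apply: phi_sequence_family hd hphi hz wK aP _ _ _ => [|i j ij jl|j _].
  - by case: llim.
  - exact: ltz (lt_trans ij jl).
  - exact: ltz.
exact: phi_sequence_approximation.
Qed.
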